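(* Let $p$ be a prime and $k\geq 1$ an integer. Then $a(p^k)=k(p-1)+1$.
   Context: For a positive integer $n$, consider the random walk on $\mathbb{Z}/n\mathbb{Z}$ that starts at the residue $1 \pmod n$ and at each step multiplies the current state by a residue chosen uniformly at random from $\mathbb{Z}/n\mathbb{Z}$, independently of previous choices. The state $0\pmod n$ is absorbing. $a(n)$ denotes the expected number of steps until the walk first reaches $0 \pmod n$ (so $a(1)=0$). *)

(* Defs.v *)
From HB Require Import structures.
From mathcomp Require Import all_boot all_order all_algebra.
From mathcomp Require Import finmap.
From mathcomp Require Import all_classical all_reals all_analysis.

Set Implicit Arguments.
Unset Strict Implicit.
Unset Printing Implicit Defensive.

Import Order.TTheory GRing.Theory Num.Theory.
Local Open Scope classical_set_scope.
Local Open Scope ring_scope.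

(* Residues modulo n for every n > 0: the least residues 0, ..., n - 1, with the
   operations [Zp0], [Zp1], [Zp_mul] of zmodp.v.  For n > 1 this is the ring
   ['Z_n]; unlike ['Z_1], which is Z/2Z, [residue 1] has one element (where
   Zp1 = Zp0).  Only n = 0 is junk. *)
Definition residue (n : nat) := 'I_n.-1.+1.

Section Walk.
Variable n : nat.

Fixpoint walk (r : nat -> residue n) (t : nat) : residue n :=
  if t is s.+1 then Zp_mul (walk r s) (r s) else Zp1.

(* Time 0 counts; the value is +oo when the walk never reaches 0. *)
Definition hitting_time (R : realType) (r : nat -> residue n) : \bar R :=
  ereal_inf [set (t%:R)%:E | t in [set t | walk r t = Zp0]].

End Walk.

Section RandomSequences.
Context (d : measure_display) (T : measurableType d) (R : realType).
Variable P : probability T R.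

(* Measurability with respect to the discrete sigma-algebra on S. *)
Definition discrete_rv (S : Type) (X : T -> S) : Prop :=
  forall A : set S, measurable (X @^-1` A).

Definition mutually_independent (S : Type) (X : nat -> T -> S) : Prop :=
  forall (J : {fset nat}) (A : nat -> set S),
    P (\bigcap_(i in [set` J]) (X i @^-1` A i)) =
    (\prod_(i <- J) P (X i @^-1` A i))%E.

Definition uniform_rv (n : nat) (X : T -> residue n) : Prop :=
  forall x : residue n, P (X @^-1` [set x]) = (n%:R^-1)%:E.

Definition iid_uniform (n : nat) (X : nat -> T -> residue n) : Prop :=
  [/\ forall i, discrete_rv (X i),
      forall i, uniform_rv (X i) &
      mutually_independent X].

(* The expectation ['E_P[_]] of the library is for real-valued functions only. *)
Definition expected_hitting_time (n : nat) (X : nat -> T -> residue n) : \bar R :=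
  (\int[P]_w hitting_time R (fun i => X i w))%E.

End RandomSequences.

(* Main.v *)
(* The function h(x) = v (p - 1) + 1 for x <> 0, h(0) = 0, where p^(k - v) is the
   exact power of p dividing x, drops by exactly 1 on average in one step from
   any x <> 0. Summing the drops, sum_(t < m) P(W_t <> 0) = h(1) - E h(W_m). The
   partial sums are thus bounded, so P(W_m <> 0) --> 0, hence E h(W_m) --> 0, and
   the expected hitting time sum_t P(W_t <> 0) is h(1) = k (p - 1) + 1. *)
Require Import Defs.
From HB Require Import structures.
From mathcomp Require Import all_boot all_order all_algebra.
From mathcomp Require Import finmap.
From mathcomp Require Import all_classical all_reals all_analysis.
From mathcomp Require Import ring lra zify.

Set Implicit Arguments.
Unset Strict Implicit.
Unset Printing Implicit Defensive.

Import Order.TTheory GRing.Theory Num.Theory.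
Import numFieldNormedType.Exports.
Local Open Scope classical_set_scope.
Local Open Scope ring_scope.

(** * Counting multiples of prime powers, and the average drop of the potential *)

Lemma sum_dvdn_ord (m e : nat) : (0 < m)%N -> (e %| m)%N ->
  (\sum_(r < m) (e %| r) = m %/ e)%N.
Proof.
(* [divn_count_dvd] counts over 1, ..., m instead of 0, ..., m - 1; both end terms equal 1. *)
move=> m0 em; apply: (@addnI (e %| 0)%N).
rewrite divn_count_dvd -(@big_ltn _ 0%N _ 0%N _ (fun i => nat_of_bool (e %| i)%N)) //.
by rewrite big_nat_recr //= big_mkord em dvdn0 addnC.
Qed.

Lemma dvdn_modl e N m : (e %| N)%N -> (e %| m %% N)%N = (e %| m)%N.
Proof. by move=> eN; rewrite /dvdn modn_dvdm. Qed.

(** With j = [logn p x], the cofactor of p^j in x is coprime to p, so p^i divides x r iff p^(i - j)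
    divides r. Truncated subtraction covers i <= j, when every r counts. *)
Lemma sum_dvdn_mul_pexp (p k i x : nat) : prime p -> (0 < x)%N -> (i <= k)%N ->
  (\sum_(r < p ^ k) (p ^ i %| x * r %% p ^ k) = p ^ (k - (i - logn p x)))%N.
Proof.
move=> pp x0 ik; have p0 := prime_gt0 pp.
have [m pm xE] := pfactor_coprime pp x0.
under eq_bigr => r _ do rewrite dvdn_modl ?dvdn_exp2l //.
set j := logn p x in xE *.
have [ij|ji] := leqP i j.
  have /eqP-> : (i - j == 0)%N by rewrite subn_eq0.
  rewrite (eq_bigr (fun=> 1%N)) ?sum_nat_const ?card_ord ?muln1 ?subn0 //.
  move=> r _; rewrite dvdn_mulr // xE dvdn_mull // dvdn_exp2l //.
rewrite (eq_bigr (fun r : 'I_ _ => nat_of_bool (p ^ (i - j) %| r)%N)).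
  rewrite sum_dvdn_ord ?expn_gt0 ?p0 ?dvdn_exp2l -?expnB //; lia.
move=> r _; rewrite xE -{1}(subnK (ltnW ji)) expnD.
rewrite [(m * _)%N]mulnC -mulnA [(p ^ (i-j) * _)%N]mulnC dvdn_pmul2l ?expn_gt0 ?p0 //.
by rewrite Gauss_dvdr // coprimeXl.
Qed.

(* Layer-cake form of the function h of the header: averaging over r only needs
   the number of r with p^i %| x * r, for each i. *)
Definition potential (R : numDomainType) (p k x : nat) : R :=
  (~~ (p ^ k %| x)%N)%:R + (p - 1)%:R * \sum_(i < k) (~~ (p ^ i.+1 %| x)%N)%:R.

(** The layers that contribute are those with [logn p x <= i < k]; their number is the v of the
    header. *)
Lemma potentialE (R : numDomainType) (p k x : nat) : prime p -> ~~ (p ^ k %| x)%N ->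
  potential R p k x = ((p - 1) * (k - logn p x) + 1)%:R.
Proof.
move=> pp xk; have x0 : (0 < x)%N by case: x xk => //; rewrite dvdn0.
rewrite /potential xk natrD natrM addrC; congr (_ * _ + _).
rewrite -natr_sum; congr _%:R.
move: xk; rewrite pfactor_dvdn // -ltnNge.
set j := logn p x; under eq_bigr => i _ do rewrite pfactor_dvdn // -ltnNge ltnS.
move=> jk; rewrite -(big_mkord predT (fun i => nat_of_bool (j <= i)%N)).
rewrite (@big_cat_nat _ _ _ j) //=; last exact: ltnW.
rewrite big_nat_cond big1 ?add0n; last first.
  by move=> i; rewrite andbT => /andP[_ ij]; rewrite leqNgt ij.
rewrite big_nat_cond (eq_bigr (fun=> 1%N)); last by move=> i; rewrite andbT => /andP[-> _].
by rewrite -big_nat_cond sum_nat_const_nat muln1.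
Qed.

(** With j = [logn p x], the layers i < j sum to 0, and each of the other k - j to p^k minus a power
    of p. Weighted by p - 1, these powers add up to p^k - p^j, which is exactly the sum of the
    separate first term of the potential. *)
Lemma sum_potential_mul (R : numDomainType) (p k x : nat) :
    prime p -> ~~ (p ^ k %| x)%N ->
  \sum_(r < p ^ k) potential R p k (x * r %% p ^ k) = (p ^ k)%:R * (potential R p k x - 1).
Proof.
move=> pp xk; have p0 := prime_gt0 pp.
have x0 : (0 < x)%N by case: x xk => //; rewrite dvdn0.
rewrite potentialE // natrD addrK.
rewrite big_split /= -mulr_sumr exchange_big /=.
have cnt i : (i <= k)%N ->
    \sum_(r < p ^ k) (~~ (p ^ i %| x * r %% p ^ k)%N)%:R =
    (p ^ k)%:R - (p ^ (k - (i - logn p x)))%:R :> R.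
  move=> ik; rewrite -(@sum_dvdn_mul_pexp p k i x) // natr_sum.
  rewrite -[X in X%:R - _](card_ord (p ^ k)) -sumr_const -sumrB.
  by apply: eq_bigr => r _; case: (_ %| _)%N; rewrite ?subrr ?subr0.
rewrite cnt // (eq_bigr _ (fun (i : 'I_k) _ => cnt i.+1 (ltn_ord i))).
move: xk; rewrite pfactor_dvdn // -ltnNge; set j := logn p x => jk.
rewrite sumrB sumr_const card_ord.
rewrite -(big_mkord predT (fun i => (p ^ (k - (i.+1 - j)))%:R)).
rewrite (@big_cat_nat _ _ _ j) //=; last exact: ltnW.
have -> : \sum_(0 <= i < j) (p ^ (k - (i.+1 - j)))%:R = (p ^ k)%:R *+ j :> R.
  rewrite big_nat_cond (eq_bigr (fun=> (p ^ k)%:R)).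
    by rewrite -big_nat_cond sumr_const_nat subn0.
  by move=> i; rewrite andbT => /andP[_ ij]; congr (_ ^ _)%:R; lia.
(* Telescoping of (p - 1) p^e = p^(e + 1) - p^e over e = j, ..., k - 1. *)
have geo : (p - 1)%:R * \sum_(j <= i < k) (p ^ (k - (i.+1 - j)))%:R =
    (p ^ k)%:R - (p ^ j)%:R :> R.
  have step i : (j <= i < k)%N -> (p - 1)%:R * (p ^ (k - (i.+1 - j)))%:R =
      - (p ^ (k - (i.+1 - j)))%:R - (- (p ^ (k - (i - j)))%:R) :> R.
    move=> /andP[ji ik].
    have -> : (k - (i - j) = (k - (i.+1 - j)).+1)%N by lia.
    by rewrite expnS natrM natrB //; ring.
  rewrite mulr_sumr (eq_big_nat _ _ step).
  rewrite (telescope_sumr (fun i => - (p ^ (k - (i - j)))%:R)); last exact: ltnW.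
  by rewrite subnn subn0 subKn 1?ltnW // opprK addrC.
have -> : (k - (k - j) = j)%N by rewrite subKn // ltnW.
rewrite mulrBr mulrDr geo natrM !natrB ?(ltnW jk) //.
rewrite -(mulr_natr _ k) -(mulr_natr _ j) ?natrB ?(ltnW jk) //; ring.
Qed.

(** * Events split along a finite-valued map, and the hitting time along one path *)

Lemma measure_setI_finpred (d : measure_display) (T : measurableType d)
    (R : realType) (mu : {measure set T -> \bar R}) (I : finType) (Y : T -> I)
    (B : set T) (Q : pred I) :
    (forall i, measurable (B `&` Y @^-1` [set i])) ->
  mu (B `&` [set w | Q (Y w)]) = (\sum_(i | Q i) mu (B `&` Y @^-1` [set i]))%E.
Proof.
move=> mBY.
have -> : B `&` [set w | Q (Y w)] =
    \bigcup_(i in [set` Q]) (B `&` Y @^-1` [set i]).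
  apply/seteqP; split=> w /=.
    by move=> [Bw Qw]; exists (Y w).
  by move=> [i Qi [Bw YwE]]; split=> //=; rewrite YwE.
rewrite measure_fin_bigcup //.
- rewrite (fsbigE (enum Q)) ?enum_uniq //=.
  + by rewrite big_enum_cond; apply: eq_bigl => i; rewrite mem_setE andbb.
  + by move=> i /=; rewrite mem_enum.
  + by move=> i /= Qi; rewrite mem_enum Qi.
- by move=> i j _ _ [w [[_ /= <-] [_ /= <-]]].
Qed.

Section HittingTime.
Context (n : nat) (R : realType).
Implicit Types r : nat -> residue n.

Lemma walk_absorbed r s t :
  (s <= t)%N -> walk r s = Zp0 -> walk r t = Zp0.
Proof.
move=> /subnK <- rs0; elim: (t - s)%N => [|u IH] //=.
by rewrite IH; apply: val_inj; rewrite /= mul0n mod0n.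
Qed.

(** As 0 is absorbing, the terms are 1 before the first hit and 0 from then on. Without a hit, both
    the infimum of the empty set and the series of ones are +oo. *)
Lemma hitting_time_series r :
  hitting_time R r = (\sum_(t <oo) ((walk r t != Zp0)%:R)%:E)%E.
Proof.
rewrite /hitting_time.
case: (pselect (exists t, walk r t == Zp0)) => [hit|nohit].
- have [s /eqP rs0 s_min] := ex_minnP hit.
  rewrite (nneseries_split _ s); last by move=> t _; rewrite lee_fin.
  rewrite add0n [X in (_ + X)%E]eseries0 ?adde0; last first.
    by move=> t st _; rewrite (walk_absorbed st rs0) eqxx.
  rewrite (eq_big_nat _ _ (F2 := fun=> 1%E)); last first.
    move=> t /andP[_ ts]; case: eqP => // /eqP /s_min.
    by rewrite leqNgt ts.
  rewrite sumEFin big_const_nat iter_addr addr0 subn0.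
  apply/le_anti/andP; split.
    by apply: ereal_inf_lbound; exists s.
  apply/ereal_infP => _ [t /= rt0 <-]; rewrite lee_fin ler_nat.
  exact/s_min/eqP.
- have -> : [set t | walk r t = Zp0] = set0.
    by apply/seteqP; split=> t //= /eqP rt0; apply: nohit; exists t.
  rewrite image_set0 ereal_inf0; apply/esym/cvg_lim => //.
  have -> : (fun m => \sum_(0 <= t < m) ((walk r t != Zp0)%:R)%:E)%E =
      (fun m => (m%:R)%:E) :> (nat -> \bar R).
    apply/funext => m; under eq_bigr => t _.
      have -> : walk r t != Zp0 by apply/negP => rt0; apply: nohit; exists t.
      over.
    by rewrite sumEFin big_const_nat iter_addr addr0 subn0.
  by apply/cvgeryP; exact: cvgr_idn.
Qed.

End HittingTime.

(** * The law of the walk and its expected hitting time *)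

(** A recursion free of the probability space; [walk_lawE] identifies it with the distribution of
    the walk. *)
Fixpoint walk_law (R : realType) (n t : nat) (x : residue n) : R :=
  if t is s.+1 then
    \sum_(yz : residue n * residue n | Zp_mul yz.1 yz.2 == x)
      walk_law R s yz.1 / n%:R
  else (x == Zp1)%:R.

Lemma walk_law_ge0 (R : realType) (n t : nat) (x : residue n) :
  0 <= walk_law R t x.
Proof.
elim: t x => [|t IH] x //=.
by apply: sumr_ge0 => yz _; rewrite divr_ge0.
Qed.

Section WalkLaw.
Context (d : measure_display) (T : measurableType d) (R : realType).
Context (P : probability T R) (n : nat) (X : nat -> T -> residue n).
Hypothesis X_iid : iid_uniform P X.

Let W t w := walk (fun i => X i w) t.

Lemma measurable_walk t (A : set (residue n)) : measurable (W t @^-1` A).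
Proof.
have [mX _ _] := X_iid.
have countable_union (I : finType) (Y : T -> I) (S : set I) :
    (forall i, measurable (Y @^-1` [set i])) -> measurable (Y @^-1` S).
  move=> mY; rewrite (_ : _ @^-1` _ = \bigcup_(i in S) Y @^-1` [set i]).
    by apply: fin_bigcup_measurable => //; exact: finite_finset.
  apply/seteqP; split=> w /=; first by move=> Sw; exists (Y w).
  by move=> [i Si YwE]; rewrite YwE.
elim: t A => [|t IH] A; first by rewrite (preimage_cst (Zp1 : residue n)); case: ifP.
rewrite (_ : _ @^-1` _ = (fun w => (W t w, X t w)) @^-1`
    [set yz | A (Zp_mul yz.1 yz.2)]) //.
apply: countable_union => -[y z].
rewrite (_ : _ @^-1` _ = W t @^-1` [set y] `&` X t @^-1` [set z]).
  by apply: measurableI => //; exact: mX.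
by apply/seteqP; split=> w /= [-> ->].
Qed.

(* Carrying a finite family of events on later steps makes independence usable
   in the induction. *)
Lemma walk_law_indep t (x : residue n) (J : {fset nat})
    (A : nat -> set (residue n)) :
    (forall i, i \in J -> (t <= i)%N) ->
  (P (W t @^-1` [set x] `&` \bigcap_(i in [set` J]) (X i @^-1` A i)) =
   (walk_law R t x)%:E * \prod_(i <- J) P (X i @^-1` A i))%E.
Proof.
have [mX uX iX] := X_iid.
elim: t x J A => [|t IH] x J A Jt /=.
  rewrite /W /=; have [->|/eqP x1] := eqVneq x Zp1.
    by rewrite mul1e -iX; congr (P _); apply/seteqP; split=> w //= [].
  rewrite mul0e (_ : _ `&` _ = set0) ?measure0 //.
  by apply/seteqP; split=> w //= -[] /esym.
have tJ : t \notin J by apply/negP => /Jt; rewrite ltnn.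
set B := \bigcap_(i in _) _.
(* The condition on [X t] joins the family of later events: [t] is a fresh index because [J] lies
   beyond it. *)
have stepE (yz : residue n * residue n) :
    B `&` (fun w => (W t w, X t w)) @^-1` [set yz] =
    W t @^-1` [set yz.1] `&` \bigcap_(i in [set` (t |` J)%fset])
      (X i @^-1` (if i == t then [set yz.2] else A i)).
  case: yz => y z; apply/seteqP; split=> w /=.
    move=> [Bw [Wy Xz]]; split=> // i /=; rewrite in_fset1U.
    by case: eqP => [->//|_ /=]; exact: Bw.
  move=> [Wy Bw]; split.
    move=> i /= iJ; have := Bw i; rewrite /= in_fset1U iJ orbT.
    by case: eqP => [it|_]; [rewrite -it iJ in tJ | apply].
  have := Bw t; rewrite /= in_fset1U eqxx => /(_ isT) /= Xz.
  by rewrite Wy Xz.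
have -> : W t.+1 @^-1` [set x] `&` B = B `&`
    [set w | [pred yz | Zp_mul yz.1 yz.2 == x] (W t w, X t w)].
  by rewrite setIC; congr (_ `&` _); apply/seteqP; split=> w /= /eqP.
rewrite measure_setI_finpred; last first.
  move=> yz; rewrite stepE; apply: measurableI; first exact: measurable_walk.
  apply: fin_bigcap_measurable => // i _; exact: mX.
rewrite -sumEFin ge0_sume_distrl; last first.
  by move=> yz _; rewrite lee_fin divr_ge0 // walk_law_ge0.
apply: eq_bigr => yz _; rewrite stepE.
rewrite [LHS](IH yz.1 (t |` J)%fset (fun i => if i == t then [set yz.2] else A i)).
  rewrite big_fsetU1 //= eqxx uX EFinM muleA; congr (_ * _)%E.
  apply: eq_big_seq => i iJ; case: eqP => // it.
  by rewrite -it iJ in tJ.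
move=> i; rewrite in_fset1U => /orP[/eqP->//|/Jt]; exact: ltnW.
Qed.

Lemma walk_lawE t (Q : pred (residue n)) :
  P [set w | Q (W t w)] = (\sum_(x | Q x) walk_law R t x)%:E.
Proof.
have := @measure_setI_finpred _ _ _ P _ (W t) setT Q.
rewrite setTI => ->; last first.
  by move=> i; rewrite setTI; exact: measurable_walk.
rewrite -sumEFin; apply: eq_bigr => x _.
have := @walk_law_indep t x fset0 (fun=> setT).
rewrite big_seq_fset0 mule1 => <- //; congr (P _).
by apply/seteqP; split=> w /= [].
Qed.

(* Optional stopping for the martingale [h (W t) + min t tau]. *)
Lemma expected_hitting_time_potential (h : residue n -> R) :
    h Zp0 = 0 -> (forall x, 0 <= h x) ->
    (forall x, x != Zp0 -> \sum_(r : residue n) h (Zp_mul x r) = n%:R * (h x - 1)) ->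
    (0 < n)%N ->
  expected_hitting_time P X = (h Zp1)%:E.
Proof.
move=> h0 h_ge0 h_step n_gt0.
(* [q t] is P(W_t <> 0) and [H t] is E h(W_t). *)
pose q t := \sum_(x : residue n | x != Zp0) walk_law R t x.
pose H t := \sum_x walk_law R t x * h x.
have H_step t : H t.+1 = H t - q t.
  have -> : H t.+1 = \sum_(yz : residue n * residue n)
      walk_law R t yz.1 / n%:R * h (Zp_mul yz.1 yz.2).
    rewrite (partition_big (fun yz => Zp_mul yz.1 yz.2) predT) //=.
    apply: eq_bigr => x _; rewrite mulr_suml.
    by apply: eq_bigr => yz /eqP ->.
  rewrite -(pair_bigA _ (fun y z => walk_law R t y / n%:R * h (Zp_mul y z))) /=.
  rewrite /H /q (bigD1 Zp0) //= [in RHS](bigD1 Zp0) //= h0 mulr0 add0r.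
  rewrite big1 ?add0r => [|z _]; last first.
    rewrite (_ : Zp_mul Zp0 z = Zp0) ?h0 ?mulr0 //.
    by apply: val_inj; rewrite /= mul0n mod0n.
  rewrite -sumrB; apply: eq_bigr => y y0.
  rewrite -mulr_sumr h_step //.
  have n0 : n%:R != 0 :> R by rewrite pnatr_eq0 -lt0n.
  by field.
have H_series : series q = (fun m => h Zp1 - H m).
  apply/funext => m; rewrite /series /=.
  rewrite (eq_bigr (fun t => (- H t.+1) - (- H t))); last first.
    by move=> t _; rewrite H_step; ring.
  rewrite telescope_sumr // opprK addrC; congr (_ - _).
  rewrite /H (bigD1 Zp1) //= eqxx mul1r big1 ?addr0 // => x /negPf x1.
  by rewrite x1 mul0r.
have q_ge0 t : 0 <= q t by apply: sumr_ge0 => x _; exact: walk_law_ge0.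
have H_ge0 t : 0 <= H t.
  by apply: sumr_ge0 => x _; rewrite mulr_ge0 // walk_law_ge0.
(* The partial sums of [q] increase and, since [H] is nonnegative, stay below [h Zp1]. *)
have q_cvg0 : q @ \oo --> 0.
  apply: cvg_series_cvg_0; apply: nondecreasing_is_cvgn.
    by apply/nondecreasing_seqP => m; rewrite !seriesEnat /= big_nat_recr //= lerDl.
  exists (h Zp1) => _ [m _ <-]; rewrite H_series; have := H_ge0 m; lra.
have H_cvg0 : H @ \oo --> 0.
  (* A crude upper bound for [h]; as [h Zp0 = 0], it gives [H t <= C * q t]. *)
  pose C := \sum_x h x.
  apply: (@squeeze_cvgr _ _ _ _ (fun=> 0) (fun t => C * q t)).
  - near=> t; rewrite H_ge0 /= /H (bigD1 Zp0) //= h0 mulr0 add0r mulr_sumr.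
    apply: ler_sum => x _; rewrite mulrC ler_wpM2r ?walk_law_ge0 //.
    by rewrite /C (bigD1 x) //= lerDl sumr_ge0.
  - exact: cvg_cst.
  - by rewrite -(mulr0 C); apply: cvgMr.
have q_series : (\sum_(t <oo) (q t)%:E)%E = (h Zp1)%:E.
  apply/cvg_lim => //.
  have -> : (fun m => \sum_(0 <= t < m) (q t)%:E)%E = EFin \o series q.
    by apply/funext => m; rewrite sumEFin.
  apply: cvg_EFin; first by near=> m.
  rewrite H_series -[X in _ --> X]subr0; apply: cvgB => //; exact: cvg_cst.
rewrite /expected_hitting_time -q_series.
under eq_integral => w _ do rewrite hitting_time_series.
have nonzeroE t : (fun w => ((W t w != Zp0)%:R)%:E) =
    (fun w => (\1_[set w | W t w != Zp0] w)%:E) :> (T -> \bar R).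
  by apply/funext => w; rewrite indicE mem_setE.
have mW t : measurable [set w | W t w != Zp0].
  exact: (measurable_walk t [set x | x != Zp0]).
(* Monotone convergence: the expected hitting time is the sum of the P(W_t <> 0). *)
rewrite integral_nneseries //.
- apply: eq_eseriesr => t _; rewrite -/(W t) nonzeroE integral_indic // setIT.
  exact: (walk_lawE t (fun x => x != Zp0)).
- move=> t; rewrite -/(W t) nonzeroE; apply/measurable_realfun.measurable_EFinP.
  exact: measurable_realfun.measurable_indic.
Unshelve. all: by end_near.
Qed.

End WalkLaw.

Theorem theorem2p1 (R : realType) (d : measure_display) (T : measurableType d)
    (P : probability T R) (p k : nat) (X : nat -> T -> residue (p ^ k)%N)
    (p_prime : prime p) (k_ge1 : (1 <= k)%N) (X_iid : iid_uniform P X) :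
  expected_hitting_time P X = ((k * (p - 1) + 1)%N%:R)%:E :> \bar R.
Proof.
have N_gt0 : (0 < p ^ k)%N by rewrite expn_gt0 prime_gt0.
have N_gt1 : (1 < p ^ k)%N by rewrite -(exp1n k) ltn_exp2r ?prime_gt1.
have pk1 : ~~ (p ^ k %| 1)%N by rewrite dvdn1 gtn_eqF.
rewrite (expected_hitting_time_potential X_iid (h := fun x => potential R p k x)) //.
- have -> : (Zp1 : residue (p ^ k)) = 1%N :> nat.
    by rewrite /= modn_small // prednK.
  by rewrite potentialE // logn1 subn0 mulnC.
- by rewrite /potential dvdn0 big1 ?mulr0 ?addr0 // => i _; rewrite dvdn0.
- by move=> x; rewrite addr_ge0 ?mulr_ge0 ?sumr_ge0.
- move=> x x0.
  have pkx : ~~ (p ^ k %| x)%N.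
    rewrite /dvdn modn_small; first exact: x0.
    by rewrite -[X in (_ < X)%N]prednK.
  (* The type [residue (p ^ k)] has bound [(p ^ k).-1.+1], equal to [p ^ k] only through a proof; a
     general [m] lets the sum be transported. *)
  have sum_step m : m = (p ^ k)%N ->
      \sum_(r < m) potential R p k (x * r %% m) =
      (p ^ k)%:R * (potential R p k x - 1).
    by move=> ->; rewrite sum_potential_mul.
  by rewrite -(sum_step _ (prednK N_gt0)).
Qed.
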